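(* Let $\mathcal{P}$ be the convex cone of symmetric quartic forms $f\in\mathbb{R}[a_0,a_1,a_2,a_3]$ with $f(1,1,1,1)=0$ and $f\ge 0$ on $\mathbb{R}_+^4$. With $\sigma_k$ the $k$-th elementary symmetric polynomial of $a_0,\dots,a_3$, define $$\mathfrak{f}_t^{ab}=\tfrac13\Big(3\sigma_1^4-2(t+7)\sigma_1^2\sigma_2+8(t+1)\sigma_2^2+(t^2-6t+21)\sigma_1\sigma_3-16(t^2+3)\sigma_4\Big)\quad(0\le t\le 5),$$ $$\mathfrak{f}_t^{c}=\tfrac19\Big(9\sigma_1^4-6(t+7)\sigma_1^2\sigma_2+(t+7)^2\sigma_2^2+12(t-1)\sigma_1\sigma_3-12(t-1)(3t+13)\sigma_4\Big)\quad(t\ge 5),$$ $$\mathfrak{p}=\sigma_2^2-3\sigma_1\sigma_3+12\sigma_4,$$ $$\mathfrak{q}_1=\sigma_1^2\sigma_2-4\sigma_2^2+3\sigma_1\sigma_3=\sum_{i<j}a_ia_j(a_i-a_j)^2,$$ $$\mathfrak{q}_2=\sigma_1\sigma_3-16\sigma_4=\tfrac14\sum_{\tau\in\mathfrak{S}_4}a_{\tau(0)}a_{\tau(1)}(a_{\tau(2)}-a_{\tau(3)})^2,$$ where $\mathfrak{S}_4$ is the group of permutations of $\{0,1,2,3\}$. Then the extremal elements of $\mathcal{P}$ are exactly the positive multiples of $\mathfrak{f}_t^{ab}$ ($0\le t\le5$), $\mathfrak{f}_t^c$ ($t\ge5$), $\mathfrak{p}$, $\mathfrak{q}_1$ and $\mathfrak{q}_2$.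 Moreover: (a) for $0\le t<1$ or $1<t\le5$, $\mathfrak{f}_t^{ab}$ is characterized by the equality conditions $\mathfrak{f}_t^{ab}(t,1,1,1)=\mathfrak{f}_t^{ab}(0,0,1,1)=0$; (b) $\mathfrak{f}_1^{ab}$ is characterized by the equality conditions $\mathfrak{f}_1^{ab}(t,t,1,1)=0$ for all $t\ge0$ and $\frac{\partial^2}{\partial a_0^2}\mathfrak{f}_1^{ab}(1,1,1,1)=0$; (c) for $t>5$, $\mathfrak{f}_t^c$ is characterized by the equality conditions $\mathfrak{f}_t^c(t,1,1,1)=\mathfrak{f}_t^c(0,0,u,1)=0$, where $u\in\mathbb{R}_+$ is any root of $3u^2-(t+1)u+3=0$; (d) $\mathfrak{p}$ is characterized by the equality conditions $\mathfrak{p}(0,0,0,1)=\frac{\partial\mathfrak{p}}{\partial a_0}(0,0,0,1)=\mathfrak{p}(x,1,1,1)=0$ for all $x\ge0$; (e) $\mathfrak{q}_1$ is characterized by the equality conditions $\mathfrak{q}_1(1,1,1,0)=\mathfrak{q}_1(1,1,0,0)=\mathfrak{q}_1(1,0,0,0)=0$; (f) $\mathfrak{q}_2$ is characterized by the equality conditions $\mathfrak{q}_2(s,1,0,0)=0$ for all $s\ge0$.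
   Context: $\mathbb{R}_+=\{x\in\mathbb{R}:x\ge0\}$. An element $0\neq f\in\mathcal{P}$ is extremal if whenever $f=g+h$ with $g,h\in\mathcal{P}$, both $g$ and $h$ are scalar multiples of $f$. One says that $f\in\mathcal{P}$ is characterized by a list of equality conditions (vanishing of $f$, or of indicated partial derivatives of $f$, at given points) if the set of all $g\in\mathcal{P}$ satisfying the same conditions is exactly $\mathbb{R}_+\cdot f$.
   Formalization: Item (a) fails as printed at t=0, since q_1 also lies in P and vanishes at (0,1,1,1) and (0,0,1,1); for t=0 the formal statement adds the condition that the partial derivative in a_0 vanishes at (0,1,1,1). *)

(* Defs.v *)
From HB Require Import structures.
From mathcomp Require Import all_boot all_order all_fingroup all_algebra.
From mathcomp Require Import reals.
From mathcomp Require Import mpoly.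

Set Implicit Arguments.
Unset Strict Implicit.
Unset Printing Implicit Defensive.

Import Order.TTheory GRing.Theory Num.Theory.

Local Open Scope ring_scope.

Definition pt (R : Type) (x0 x1 x2 x3 : R) : 'I_4 -> R :=
  tnth [tuple x0; x1; x2; x3].

Definition inP (R : realType) (f : {mpoly R[4]}) : Prop :=
  [/\ f \is symmetric,
      f \is 4.-homog,
      f.@[pt 1 1 1 1] = 0
    & forall a : 'I_4 -> R, (forall i, 0 <= a i) -> 0 <= f.@[a]].

Definition extremal (R : realType) (f : {mpoly R[4]}) : Prop :=
  [/\ inP f, f != 0
    & forall g h : {mpoly R[4]}, inP g -> inP h -> f = g + h ->
        (exists c : R, g = c *: f) /\ (exists c : R, h = c *: f)].

Definition characterized (R : realType) (C : {mpoly R[4]} -> Prop)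
    (f : {mpoly R[4]}) : Prop :=
  forall g : {mpoly R[4]},
    (inP g /\ C g) <-> exists2 c : R, 0 <= c & g = c *: f.

Definition sigma (R : realType) (k : nat) : {mpoly R[4]} := mesym 4 R k.

(* At t = 0 the zero (t, 1, 1, 1) of fab t lies on the boundary of the orthant,
   so for g in the cone g(0, 1, 1, 1) = 0 does not force the derivative of g in
   a_0 to vanish there: q1 below vanishes at (0, 1, 1, 1) and (0, 0, 1, 1), as
   fab 0 does, but only fab 0 vanishes to order two along (x, 1, 1, 1) at 0. *)
Definition fab (R : realType) (t : R) : {mpoly R[4]} :=
  3^-1 *: (3 *: sigma R 1 ^+ 4
           - (2 * (t + 7)) *: (sigma R 1 ^+ 2 * sigma R 2)
           + (8 * (t + 1)) *: sigma R 2 ^+ 2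
           + (t ^+ 2 - 6 * t + 21) *: (sigma R 1 * sigma R 3)
           - (16 * (t ^+ 2 + 3)) *: sigma R 4).

Definition fc (R : realType) (t : R) : {mpoly R[4]} :=
  9^-1 *: (9 *: sigma R 1 ^+ 4
           - (6 * (t + 7)) *: (sigma R 1 ^+ 2 * sigma R 2)
           + (t + 7) ^+ 2 *: sigma R 2 ^+ 2
           + (12 * (t - 1)) *: (sigma R 1 * sigma R 3)
           - (12 * (t - 1) * (3 * t + 13)) *: sigma R 4).

Definition p (R : realType) : {mpoly R[4]} :=
  sigma R 2 ^+ 2 - 3 *: (sigma R 1 * sigma R 3) + 12 *: sigma R 4.

Definition q1 (R : realType) : {mpoly R[4]} :=
  sigma R 1 ^+ 2 * sigma R 2 - 4 *: sigma R 2 ^+ 2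
  + 3 *: (sigma R 1 * sigma R 3).

Definition q2 (R : realType) : {mpoly R[4]} :=
  sigma R 1 * sigma R 3 - 16 *: sigma R 4.

(* Main.v *)
Require Import Defs.
From HB Require Import structures.
From mathcomp Require Import all_boot all_order all_fingroup all_algebra.
From mathcomp Require Import reals.
From mathcomp Require Import mpoly.
From mathcomp Require Import zify ring lra.

Set Implicit Arguments.
Unset Strict Implicit.
Unset Printing Implicit Defensive.

Import Order.TTheory GRing.Theory Num.Theory.

Local Open Scope ring_scope.

(** A symmetric quartic form vanishing at (1,1,1,1) is determined by the four
numbers A, M, K, N for which

  f(x,1,1,1) = (x-1)^2 (A x^2 + M x + N),
  f(0,0,u,1) = u^2 (A r^2 + (10 A + M)/3 r + K)   with r = (u-1)^2 / u,

and nonnegativity on the orthant makes both quadratics nonnegative on the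
half line. The point of the proof is that these two conditions are also
sufficient ([inP_cform]), so that the cone becomes an explicit set of
quadruples ([coneP]).

In the coordinates (A, M, K, N) the forms p, q1, q2 are (0,0,1,0), (0,3,0,0),
(0,0,0,3), and both families are (1, -2t, k(t), t^2) with k(t) = 0 up to t = 5
and k(t) = ((t-5)/3)^2 beyond: the first quadratic is (x-t)^2, and k(t) is the
least K for which the second one is nonnegative. If A > 0, then letting t be
the nonnegative minimizer of the first quadratic writes (A, M, K, N) as A times
a member of the family plus a nonnegative combination of p, q1, q2; if A = 0,
then M, K, N are nonnegative ([cone_split]). Hence every element of the cone is
a nonnegative combination of the listed forms, and these are the only
candidates for extremal elements. Conversely, a quadratic which is nonnegative
on the half line and vanishes at a point t > 0 is a multiple of (x-t)^2
([quad_ge0_root]). This makes each listed form extremal and makes the listed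
equality conditions characterize it.

What remains is the nonnegativity of the listed forms. For p, q1, q2 it is seen
from expressions by squares. For the two families, a form which is affine in
the product of three of the variables, once their first two elementary
symmetric functions are fixed, attains its minimum where two of the three agree
or one vanishes ([ge0_of_affine_product]); applied twice this leaves the points
(x,x,y,z) ([quartic_at_ge0]). There the form is a polynomial in x,
e = (y+z)/2 - x and the square ((y-z)/2)^2 for which [fab_kernel] and
[fc_kernel] give a quadratic-form argument. *)

(** * Symmetric quartics and their coordinates *)

Local Notation widen := (widen_ord (leqnSn _)).

Definition i0 : 'I_4 := @Ordinal 4 0 isT.
Definition i1 : 'I_4 := @Ordinal 4 1 isT.
Definition i2 : 'I_4 := @Ordinal 4 2 isT.
Definition i3 : 'I_4 := @Ordinal 4 3 isT.

Lemma sigmaE (R : realType) :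
  [/\ sigma R 1 = 'X_i0 + 'X_i1 + 'X_i2 + 'X_i3,
      sigma R 2 = 'X_i0 * 'X_i1 + 'X_i0 * 'X_i2 + 'X_i0 * 'X_i3
                  + 'X_i1 * 'X_i2 + 'X_i1 * 'X_i3 + 'X_i2 * 'X_i3,
      sigma R 3 = 'X_i0 * 'X_i1 * 'X_i2 + 'X_i0 * 'X_i1 * 'X_i3
                  + 'X_i0 * 'X_i2 * 'X_i3 + 'X_i1 * 'X_i2 * 'X_i3
    & sigma R 4 = 'X_i0 * 'X_i1 * 'X_i2 * 'X_i3].
Proof.
have w1 n (i : 'I_n) : mwiden ('X_i : {mpoly R[n]}) = 'X_(widen i).
  by rewrite mwidenX mnmwiden1.
have e3 : @ord_max 3 = i3 by apply: val_inj.
have e2 : widen (@ord_max 2) = i2 by apply: val_inj.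
have s22 : mesym 2 R 2 = 'X_ord0 * 'X_ord_max.
  rewrite mesymnnE !big_ord_recl big_ord0 mulr1; congr (_ * 'X_ _).
  exact: val_inj.
have s21 : mesym 2 R 1 = 'X_ord0 + 'X_ord_max.
  rewrite mesym1E !big_ord_recl big_ord0 addr0; congr (_ + 'X_ _).
  exact: val_inj.
have s32 : mesym 3 R 2 = 'X_(widen ord0) * 'X_(widen ord_max)
    + ('X_(widen ord0) + 'X_(widen ord_max)) * 'X_ord_max.
  by rewrite mesymSS s22 s21 mwidenM mwidenD !w1.
have s31 : mesym 3 R 1 = 'X_(widen ord0) + 'X_(widen ord_max) + 'X_ord_max.
  rewrite mesym1E !big_ord_recl big_ord0 addr0 addrA.
  congr ('X_ _ + 'X_ _ + 'X_ _); exact: val_inj.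
have s33 : mesym 3 R 3 = 'X_(widen ord0) * 'X_(widen ord_max) * 'X_ord_max.
  rewrite mesymnnE !big_ord_recl big_ord0 mulr1 mulrA.
  congr ('X_ _ * 'X_ _ * 'X_ _); exact: val_inj.
have e1 : widen (widen (@ord_max 1)) = i1 by apply: val_inj.
have e0 : widen (widen (@ord0 1)) = i0 by apply: val_inj.
rewrite /sigma; split.
- by rewrite mesymSS mesym0E mwiden1 mul1r s31 !mwidenD !w1 e0 e1 e2 e3.
- rewrite mesymSS s32 s31 !mwidenD !mwidenM mwidenD !w1 e0 e1 e2 e3. ring.
- rewrite mesymSS s33 s32 !mwidenD !mwidenM mwidenD !w1 e0 e1 e2 e3. ring.
- rewrite mesymnnE !big_ord_recl big_ord0 mulr1 !mulrA.
  congr ('X_ _ * 'X_ _ * 'X_ _ * 'X_ _); exact: val_inj.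
Qed.

Definition quartic (R : realType) (A B C D E : R) : {mpoly R[4]} :=
  A *: sigma R 1 ^+ 4 + B *: (sigma R 1 ^+ 2 * sigma R 2) + C *: sigma R 2 ^+ 2
  + D *: (sigma R 1 * sigma R 3) + E *: sigma R 4.

(** The normalization is such that A, M, K, N are the coordinates described
above; see [cform_at_x111] and [cform_at_001x]. *)
Definition cform (R : realType) (A M K N : R) : {mpoly R[4]} :=
  A *: fab 0 + (M / 3) *: q1 R + K *: p R + (N / 3) *: q2 R.

Lemma quarticD (R : realType) (A B C D E A' B' C' D' E' : R) :
  quartic A B C D E + quartic A' B' C' D' E' =
  quartic (A + A') (B + B') (C + C') (D + D') (E + E').
Proof. by rewrite /quartic !scalerDl; ring. Qed.

Lemma quarticZ (R : realType) (c A B C D E : R) :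
  c *: quartic A B C D E = quartic (c * A) (c * B) (c * C) (c * D) (c * E).
Proof. by rewrite /quartic !scalerDr !scalerA. Qed.

Lemma fab_quartic (R : realType) (t : R) :
  fab t = quartic 1 (- (2 * (t + 7) / 3)) (8 * (t + 1) / 3)
    ((t ^+ 2 - 6 * t + 21) / 3) (- (16 * (t ^+ 2 + 3) / 3)).
Proof.
rewrite /fab /quartic -!scaleNr !scalerDr !scalerA.
by congr (_ *: _ + _ *: _ + _ *: _ + _ *: _ + _ *: _); field.
Qed.

Lemma fc_quartic (R : realType) (t : R) :
  fc t = quartic 1 (- (6 * (t + 7) / 9)) ((t + 7) ^+ 2 / 9)
    (12 * (t - 1) / 9) (- (12 * (t - 1) * (3 * t + 13) / 9)).
Proof.
rewrite /fc /quartic -!scaleNr !scalerDr !scalerA.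
by congr (_ *: _ + _ *: _ + _ *: _ + _ *: _ + _ *: _); field.
Qed.

Lemma p_quartic (R : realType) : p R = quartic 0 0 1 (- 3) 12.
Proof. by rewrite /p /quartic !scale0r !add0r scale1r scaleNr. Qed.

Lemma q1_quartic (R : realType) : q1 R = quartic 0 1 (- 4) 3 0.
Proof. by rewrite /q1 /quartic !scale0r !add0r addr0 scale1r scaleNr. Qed.

Lemma q2_quartic (R : realType) : q2 R = quartic 0 0 0 1 (- 16).
Proof. by rewrite /q2 /quartic !scale0r !add0r scale1r scaleNr. Qed.

Lemma cform_quartic (R : realType) (A M K N : R) :
  cform A M K N =
  quartic A ((M - 14 * A) / 3) ((8 * A - 4 * M) / 3 + K)
    (7 * A + M - 3 * K + N / 3) (12 * K - 16 * A - 16 * N / 3).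
Proof.
rewrite /cform fab_quartic p_quartic q1_quartic q2_quartic !quarticZ !quarticD.
by congr quartic; field.
Qed.

Lemma cformD (R : realType) (A M K N A' M' K' N' : R) :
  cform A M K N + cform A' M' K' N' = cform (A + A') (M + M') (K + K') (N + N').
Proof. by rewrite !cform_quartic quarticD; congr quartic; field. Qed.

Lemma cformZ (R : realType) (c A M K N : R) :
  c *: cform A M K N = cform (c * A) (c * M) (c * K) (c * N).
Proof. by rewrite !cform_quartic quarticZ; congr quartic; field. Qed.

Lemma fab_cform (R : realType) (t : R) : fab t = cform 1 (- 2 * t) 0 (t ^+ 2).
Proof. by rewrite cform_quartic fab_quartic; congr quartic; field. Qed.

Lemma fc_cform (R : realType) (t : R) :
  fc t = cform 1 (- 2 * t) (((t - 5) / 3) ^+ 2) (t ^+ 2).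
Proof. by rewrite cform_quartic fc_quartic; congr quartic; field. Qed.

Lemma p_cform (R : realType) : p R = cform 0 0 1 0.
Proof. by rewrite cform_quartic p_quartic; congr quartic; field. Qed.

Lemma q1_cform (R : realType) : q1 R = cform 0 3 0 0.
Proof. by rewrite cform_quartic q1_quartic; congr quartic; field. Qed.

Lemma q2_cform (R : realType) : q2 R = cform 0 0 0 3.
Proof. by rewrite cform_quartic q2_quartic; congr quartic; field. Qed.

(** The value of [quartic] as a function of four scalars, over any real field,
so that the inequalities can be proved by pure field arithmetic. *)
Definition quartic_at (R : realFieldType) (A B C D E a b c d : R) : R :=
  let s1 := a + b + c + d in
  let s2 := a * b + a * c + a * d + b * c + b * d + c * d in
  let s3 := a * b * c + a * b * d + a * c * d + b * c * d in
  A * s1 ^+ 4 + B * (s1 ^+ 2 * s2) + C * s2 ^+ 2 + D * (s1 * s3)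
  + E * (a * b * c * d).

Lemma meval_quartic (R : realType) (A B C D E : R) (x : 'I_4 -> R) :
  (quartic A B C D E).@[x] = quartic_at A B C D E (x i0) (x i1) (x i2) (x i3).
Proof.
have [s1 s2 s3 s4] := sigmaE R.
by rewrite /quartic s1 s2 s3 s4 !(mevalD, mevalZ, mevalM, mevalXU, rmorphXn).
Qed.

Definition cform_at (R : realFieldType) (A M K N a b c d : R) : R :=
  quartic_at A ((M - 14 * A) / 3) ((8 * A - 4 * M) / 3 + K)
    (7 * A + M - 3 * K + N / 3) (12 * K - 16 * A - 16 * N / 3) a b c d.

Lemma meval_cform (R : realType) (A M K N : R) (x : 'I_4 -> R) :
  (cform A M K N).@[x] = cform_at A M K N (x i0) (x i1) (x i2) (x i3).
Proof. by rewrite cform_quartic meval_quartic. Qed.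

Lemma meval_cform_pt (R : realType) (A M K N a b c d : R) :
  (cform A M K N).@[pt a b c d] = cform_at A M K N a b c d.
Proof. by rewrite meval_cform /pt !(tnth_nth 0). Qed.

Lemma cform_at_x111 (R : realFieldType) (A M K N x : R) :
  cform_at A M K N x 1 1 1 = (x - 1) ^+ 2 * (A * x ^+ 2 + M * x + N).
Proof. by rewrite /cform_at /quartic_at; field. Qed.

Lemma cform_at_001x (R : realFieldType) (A M K N u v : R) :
  cform_at A M K N 0 0 u v =
  A * (u - v) ^+ 4 + (10 * A + M) / 3 * ((u - v) ^+ 2 * (u * v))
  + K * (u * v) ^+ 2.
Proof. by rewrite /cform_at /quartic_at; field. Qed.

Lemma mderiv0_sigma (R : realType) :
  [/\ (sigma R 1)^`M(ord0) = 1,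
      (sigma R 2)^`M(ord0) = 'X_i1 + 'X_i2 + 'X_i3,
      (sigma R 3)^`M(ord0) = 'X_i1 * 'X_i2 + 'X_i1 * 'X_i3 + 'X_i2 * 'X_i3
    & (sigma R 4)^`M(ord0) = 'X_i1 * 'X_i2 * 'X_i3].
Proof.
have [s1 s2 s3 s4] := sigmaE R.
have d0 : ('X_i0 : {mpoly R[4]})^`M(ord0) = 1.
  have -> : i0 = ord0 by apply: val_inj.
  by rewrite mderivX mnm1E eqxx scale1r -[X in (X - _)%MM]add0m addmK mpolyX0.
have d1 i : i != i0 -> ('X_i : {mpoly R[4]})^`M(ord0) = 0.
  have -> : i0 = ord0 by apply: val_inj.
  by move=> ne; rewrite mderivX mnm1E (negPf ne) scale0r.
have [[d11 d12] d13] := (d1 i1 isT, d1 i2 isT, d1 i3 isT).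
rewrite s1 s2 s3 s4; split; rewrite ?mderivD ?mderivM ?d0 ?d11 ?d12 ?d13;
  rewrite ?mul0r ?mul1r ?mulr0 ?mulr1.
- by rewrite !addr0.
- ring.
- ring.
- ring.
Qed.

Lemma mderiv0_quartic (R : realType) (A B C D E : R) :
  (quartic A B C D E)^`M(ord0) =
  let d2 := 'X_i1 + 'X_i2 + 'X_i3 in
  let d3 := 'X_i1 * 'X_i2 + 'X_i1 * 'X_i3 + 'X_i2 * 'X_i3 in
  (4 * A) *: sigma R 1 ^+ 3
  + B *: (sigma R 1 * sigma R 2 *+ 2 + sigma R 1 ^+ 2 * d2)
  + C *: (sigma R 2 * d2 *+ 2) + D *: (sigma R 3 + sigma R 1 * d3)
  + E *: ('X_i1 * 'X_i2 * 'X_i3).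
Proof.
have [s1 s2 s3 s4] := mderiv0_sigma R.
rewrite /quartic !mderivD !mderivZ !expr2 (exprM _ 2 2) !expr2 !mderivM.
rewrite s1 s2 s3 s4.
congr (_ + _ *: _ + _ *: _ + _ *: _ + _); last by ring.
- rewrite (mulrC 4 A) -scalerA; congr (_ *: _).
  rewrite -[4]/(4%:R) scaler_nat; ring.
- ring.
- ring.
Qed.

Lemma mderiv00_quartic_1111 (R : realType) (A B C D E : R) :
  (((quartic A B C D E)^`M(ord0))^`M(ord0)).@[pt 1 1 1 1] =
  192 * A + 60 * B + 18 * C + 6 * D.
Proof.
have [s1 s2 s3 s4] := mderiv0_sigma R.
have d1 i : i != ord0 -> ('X_i : {mpoly R[4]})^`M(ord0) = 0.
  by move=> ne; rewrite mderivX mnm1E (negPf ne) scale0r.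
have [[d11 d12] d13] := (d1 i1 isT, d1 i2 isT, d1 i3 isT).
have ev i : ('X_i : {mpoly R[4]}).@[pt 1 1 1 1] = 1.
  by rewrite mevalXU; case: i => -[|[|[|[|]]]].
have [e1 e2 e3 e4] := sigmaE R.
have v1 : (sigma R 1).@[pt 1 1 1 1] = 4.
  by rewrite e1 !mevalD !ev; ring.
have v2 : (sigma R 2).@[pt 1 1 1 1] = 6.
  by rewrite e2 !mevalD !mevalM !ev; ring.
rewrite mderiv0_quartic /= !(exprS, expr0, mulr1) !mderivD !mderivZ !mderivM.
rewrite !mderivMn !mderivD !mderivM !mderivD.
rewrite s1 s2 s3 d11 d12 d13.
rewrite !mderivM d11 d12 d13 !(mul0r, mulr0, mul1r, mulr1, addr0).
by rewrite !(mevalD, mevalZ, mevalMn, mevalM, meval0, ev, v1, v2); ring.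
Qed.

Lemma mderiv0_cform_0111 (R : realType) (A M K N : R) :
  ((cform A M K N)^`M(ord0)).@[pt 0 1 1 1] = M - 2 * N.
Proof.
have [e1 e2 e3 e4] := sigmaE R.
rewrite cform_quartic mderiv0_quartic e1 e2 e3 /=.
rewrite !(mevalD, mevalZ, mevalM, mevalMn, mevalXU, rmorphXn).
rewrite /pt !(tnth_nth 0) /=.
by field.
Qed.

Lemma mderiv0_cform_0001 (R : realType) (A M K N : R) :
  ((cform A M K N)^`M(ord0)).@[pt 0 0 0 1] = (M - 2 * A) / 3.
Proof.
have [e1 e2 e3 e4] := sigmaE R.
rewrite cform_quartic mderiv0_quartic e1 e2 e3 /=.
rewrite !(mevalD, mevalZ, mevalM, mevalMn, mevalXU, rmorphXn).
rewrite /pt !(tnth_nth 0) /=.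
by field.
Qed.

Lemma mderiv00_cform_1111 (R : realType) (A M K N : R) :
  (((cform A M K N)^`M(ord0))^`M(ord0)).@[pt 1 1 1 1] = 2 * (A + M + N).
Proof. by rewrite cform_quartic mderiv00_quartic_1111; field. Qed.

(** By the fundamental theorem of symmetric polynomials f is a polynomial of
weight 4 in the elementary symmetric polynomials, and there are five monomials
of weight 4. *)
Lemma quartic_of_sym_homog (R : realType) (f : {mpoly R[4]}) :
  f \is symmetric -> f \is 4.-homog ->
  exists A B C D E, f = quartic A B C D E.
Proof.
move=> fs fh; have [t [<- th]] := sym_fundamental_homog fs fh.
rewrite comp_mpolyE big_seq.
apply: (big_ind (fun g => exists A B C D E, g = quartic A B C D E)).
- exists 0, 0, 0, 0, 0; rewrite /quartic !scale0r !addr0. done.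
- move=> g h [A [B [C [D [E ->]]]]] [A' [B' [C' [D' [E' ->]]]]].
  by rewrite quarticD; do 5!eexists.
move=> m mt.
have [A [B [C [D [E ->]]]]] : exists A B C D E, \prod_(i < 4)
  tnth [tuple mesym 4 R i.+1  | i < 4] i ^+ m i = quartic A B C D E; last first.
  by rewrite quarticZ; do 5!eexists.
have wm : mnmwgt m = 4 by exact: (dhomogP _ _ _ th _ mt).
move: wm; rewrite /mnmwgt !big_ord_recr !big_ord0 /= !tnth_mktuple /= mul1r.
rewrite -/(sigma R 1) -/(sigma R 2) -/(sigma R 3) -/(sigma R 4).
move: (m _) (m _) (m _) (m _) => m4 m3 m2 m1 wm.
have [[c|c|c]|[c|c]] :
    ([\/ [/\ m1 = 4, m2 = 0, m3 = 0 & m4 = 0],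
        [/\ m1 = 2, m2 = 1, m3 = 0 & m4 = 0]
      | [/\ m1 = 0, m2 = 2, m3 = 0 & m4 = 0]] \/
    [\/ [/\ m1 = 1, m2 = 0, m3 = 1 & m4 = 0]
      | [/\ m1 = 0, m2 = 0, m3 = 0 & m4 = 1]])%N.
  move: wm; case: m4 => [|[|m4]]; case: m3 => [|[|m3]];
  case: m2 => [|[|[|m2]]] wm;
  by first [exfalso; lia | left; constructor 1; split; lia
    | left; constructor 2; split; lia | left; constructor 3; split; lia
    | right; constructor 1; split; lia | right; constructor 2; split; lia].
all: case: c => -> -> -> ->; rewrite ?expr0 ?expr1 ?mul1r ?mulr1 /quartic.
- by exists 1, 0, 0, 0, 0; rewrite !scale0r scale1r !addr0.
- by exists 0, 1, 0, 0, 0; rewrite !scale0r scale1r !addr0 add0r.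
- by exists 0, 0, 1, 0, 0; rewrite !scale0r scale1r !addr0 add0r.
- by exists 0, 0, 0, 1, 0; rewrite !scale0r scale1r !addr0 add0r.
- by exists 0, 0, 0, 0, 1; rewrite !scale0r scale1r !addr0 add0r.
Qed.

Lemma sym_quartic (R : realType) (A B C D E : R) :
  quartic A B C D E \is symmetric.
Proof. by rewrite /quartic !(rpredD, rpredZ, rpredM, rpredX) ?mesym_sym. Qed.

Lemma homog_quartic (R : realType) (A B C D E : R) :
  quartic A B C D E \is 4.-homog.
Proof.
have s k : sigma R k \is k.-homog by exact: dhomog_mesym.
rewrite /quartic !rpredD // rpredZ //.
- exact: (dhomogMn 4 (s 1)).
- exact: (dhomogM (dhomogMn 2 (s 1)) (s 2)).
- exact: (dhomogMn 2 (s 2)).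
- exact: (dhomogM (s 1) (s 3)).
- exact: (s 4).
Qed.

(** * Nonnegativity of the generators *)

(** For fixed s = x+y+z = 3m and q = xy+xz+yz = 3(m^2-d^2), the discriminant of
the cubic with roots x, y, z bounds the product xyz between
(m+d)^2 (m-2d) and (m-d)^2 (m+2d), with equality at triples having a double
entry. The affine function is therefore minimal at one of these triples, or,
when the lower bound is negative and so not reached in the orthant, at a triple
(0, y, z). *)
Lemma ge0_of_affine_product (R : rcfType) (U V : R -> R -> R)
    (phi := fun x y z => U (x + y + z) (x * y + x * z + y * z)
              + V (x + y + z) (x * y + x * z + y * z) * (x * y * z)) :
  (forall x y, 0 <= x -> 0 <= y -> 0 <= phi x x y) ->
  (forall x y, 0 <= x -> 0 <= y -> 0 <= phi 0 x y) ->
  forall x y z, 0 <= x -> 0 <= y -> 0 <= z -> 0 <= phi x y z.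
Proof.
move=> phi2 phi0 x y z x0 y0 z0.
pose s := x + y + z; pose q := x * y + x * z + y * z.
pose m := s / 3; pose d := Num.sqrt (m ^+ 2 - q / 3).
have dd : d ^+ 2 = m ^+ 2 - q / 3.
  rewrite sqr_sqrtr // /m /s /q.
  have -> : ((x + y + z) / 3) ^+ 2 - (x * y + x * z + y * z) / 3
    = ((x - y) ^+ 2 + (y - z) ^+ 2 + (z - x) ^+ 2) / 18 by field.
  by rewrite divr_ge0 // !addr_ge0 // sqr_ge0.
have d0 : 0 <= d by exact: sqrtr_ge0.
have q0 : 0 <= q by rewrite !addr_ge0 ?mulr_ge0.
have m0 : 0 <= m by rewrite divr_ge0 // !addr_ge0.
have dm : d <= m.
  by rewrite -(@ler_pXn2r _ 2) ?nnegrE // dd lerBlDr lerDl divr_ge0.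
pose c := x * y * z - m ^+ 3 + 3 * m * d ^+ 2.
have cd : c ^+ 2 <= (2 * d ^+ 3) ^+ 2.
  rewrite -subr_ge0.
  have -> : (2 * d ^+ 3) ^+ 2 - c ^+ 2
    = ((x - y) * (y - z) * (z - x)) ^+ 2 / 27.
    have -> : (2 * d ^+ 3) ^+ 2 = 4 * (d ^+ 2) ^+ 3 by ring.
    by rewrite /c dd /m /s /q; field.
  by rewrite divr_ge0 // sqr_ge0.
have d30 : 0 <= 2 * d ^+ 3 by rewrite mulr_ge0 // exprn_ge0.
have {cd} [cl cu] : - (2 * d ^+ 3) <= c /\ c <= 2 * d ^+ 3.
  apply/andP; rewrite -ler_norml -(@ler_pXn2r _ 2) ?nnegrE //.
  by rewrite real_normK ?num_real.
have sm : s = 3 * m by rewrite /m; field.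
have qm : q = 3 * (m ^+ 2 - d ^+ 2) by rewrite dd; field.
rewrite /phi -/s -/q.
case: (lerP 0 (V s q)) => Vs; last first.
  have := phi2 (m - d) (m + 2 * d) ltac:(lra) ltac:(lra).
  rewrite /phi.
  have -> : m - d + (m - d) + (m + 2 * d) = s by rewrite sm; ring.
  have -> : (m - d) * (m - d) + (m - d) * (m + 2 * d) + (m - d) * (m + 2 * d)
    = q by rewrite qm; ring.
  move=> h; apply: (le_trans h); rewrite lerD2l.
  apply: ler_wnM2l; first exact: ltW.
  rewrite -subr_ge0.
  have -> : (m - d) * (m - d) * (m + 2 * d) - x * y * z = 2 * d ^+ 3 - c.
    by rewrite /c; ring.
  by rewrite subr_ge0.
case: (lerP (2 * d) m) => dm2.
  have := phi2 (m + d) (m - 2 * d) ltac:(lra) ltac:(lra).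
  rewrite /phi.
  have -> : m + d + (m + d) + (m - 2 * d) = s by rewrite sm; ring.
  have -> : (m + d) * (m + d) + (m + d) * (m - 2 * d) + (m + d) * (m - 2 * d)
    = q by rewrite qm; ring.
  move=> h; apply: (le_trans h); rewrite lerD2l; apply: ler_wpM2l => //.
  rewrite -subr_ge0.
  have -> : x * y * z - (m + d) * (m + d) * (m - 2 * d) = c - - (2 * d ^+ 3).
    by rewrite /c; ring.
  by rewrite subr_ge0.
(* Here (m + d)^2 (m - 2d) < 0, and the triple with a zero entry takes over:
   its other entries are the roots of X^2 - s X + q. *)
pose w := Num.sqrt (s ^+ 2 - 4 * q).
have s0 : 0 <= s by rewrite !addr_ge0.
have ww : w ^+ 2 = s ^+ 2 - 4 * q.
  rewrite sqr_sqrtr // sm qm.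
  have -> : (3 * m) ^+ 2 - 4 * (3 * (m ^+ 2 - d ^+ 2))
    = 3 * (2 * d - m) * (2 * d + m) by ring.
  by rewrite !mulr_ge0 //; lra.
have w0 : 0 <= w by exact: sqrtr_ge0.
have ws : w <= s.
  by rewrite -(@ler_pXn2r _ 2) ?nnegrE // ww lerBlDr lerDl mulr_ge0.
have := phi0 ((s + w) / 2) ((s - w) / 2) ltac:(lra) ltac:(lra).
rewrite /phi.
have -> : 0 + (s + w) / 2 + (s - w) / 2 = s by field.
have -> : 0 * ((s + w) / 2) + 0 * ((s - w) / 2) + (s + w) / 2 * ((s - w) / 2)
  = q.
  by transitivity ((s ^+ 2 - w ^+ 2) / 4); [field | rewrite ww; field].
move=> h; apply: (le_trans h); rewrite lerD2l; apply: ler_wpM2l => //.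
by rewrite !mul0r !mulr_ge0.
Qed.

Lemma ler_of_sqr (R : realDomainType) (a b : R) :
  0 <= b -> a ^+ 2 <= b ^+ 2 -> a <= b.
Proof.
move=> b0 ab; apply: le_trans (ler_norm a) _.
by rewrite -(@ler_pXn2r _ 2) ?nnegrE // real_normK ?num_real.
Qed.

(** The expression is 3/4 of the value of the form at (x, x, y, z), where
e = (y+z)/2 - x and dl = ((y-z)/2)^2, so that eps = -(x-y)(x-z). It is a
quadratic form in eps and Z with discriminant v^2 - 24(t+1)e^2, which settles
the case where this is nonpositive. Expanding at dl = 0 instead gives
e^2 (1-t)^2 x(x+e) + b dl + 2(t+1) dl^2; in the opposite case
v^2 > 24(t+1)e^2 the coefficient b is nonnegative, exactly because
(3t+1)(5-t) >= 0. *)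
Lemma fab_kernel (R : realFieldType) (t x e dl : R) (Z := 2 * e + (1 - t) * x)
    (v := (t + 3) * e + 2 * Z) (eps := dl - e ^+ 2) :
  0 <= t <= 5 -> 0 <= x -> 0 <= x + e -> 0 <= dl ->
  0 <= 2 * (t + 1) * eps ^+ 2 + eps * Z * v + 3 * e ^+ 2 * Z ^+ 2.
Proof.
move=> /andP[t0 t5] x0 xe dl0.
have C0 : 0 < 2 * (t + 1) by lra.
case: (lerP (v ^+ 2) (24 * (t + 1) * e ^+ 2)) => hv.
  rewrite -(pmulr_rge0 _ (_ : 0 < 4 * (2 * (t + 1)))); last by lra.
  set F := (X in 0 <= X).
  have -> : F = (2 * (2 * (t + 1)) * eps + Z * v) ^+ 2
    + Z ^+ 2 * (24 * (t + 1) * e ^+ 2 - v ^+ 2) by rewrite /F; ring.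
  by rewrite addr_ge0 ?sqr_ge0 // mulr_ge0 ?sqr_ge0 // subr_ge0.
pose b := Z * v - 4 * (t + 1) * e ^+ 2.
have -> : 2 * (t + 1) * eps ^+ 2 + eps * Z * v + 3 * e ^+ 2 * Z ^+ 2
  = e ^+ 2 * ((1 - t) ^+ 2 * (x * (x + e))) + dl * b + 2 * (t + 1) * dl ^+ 2.
  by rewrite /b /eps /v /Z; ring.
have b0 : 0 <= b.
  have he : (t + 3) * e * v <= 2 / 3 * v ^+ 2.
    apply: ler_of_sqr; first by apply: mulr_ge0 (sqr_ge0 _); lra.
    rewrite -subr_ge0.
    have -> : (2 / 3 * v ^+ 2) ^+ 2 - ((t + 3) * e * v) ^+ 2
      = v ^+ 2 * (4 / 9 * (v ^+ 2 - 24 * (t + 1) * e ^+ 2)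
                  + e ^+ 2 * ((3 * t + 1) * (5 - t) / 3)) by field.
    have tt : 0 <= (3 * t + 1) * (5 - t) by apply: mulr_ge0; lra.
    apply: mulr_ge0 (sqr_ge0 _) _; apply: addr_ge0; first by lra.
    by apply: mulr_ge0 (sqr_ge0 _) _; lra.
  have -> : b = v ^+ 2 / 2 - (t + 3) * e * v / 2 - 4 * (t + 1) * e ^+ 2.
    by rewrite /b /v; field.
  lra.
apply: addr_ge0; first apply: addr_ge0.
- exact: mulr_ge0 (sqr_ge0 _) (mulr_ge0 (sqr_ge0 _) (mulr_ge0 x0 xe)).
- exact: mulr_ge0 dl0 b0.
- exact: mulr_ge0 (ltW C0) (sqr_ge0 _).
Qed.

(** As for [fab_kernel], the leading coefficient being now (t+7)^2/12, which
makes the discriminant v^2 - (t+7)^2 e^2 nonpositive for |v| <= (t+7)|e|.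
For e <= 0 the coefficient b of dl is nonnegative because x >= -e makes Z and v
very negative. For e > 0 one always has v <= (t+7)e, and b >= 0 when
v < -(t+7)e. *)
Lemma fc_kernel (R : realFieldType) (t x e dl : R) (Z := 2 * e + (1 - t) * x)
    (v := (t + 3) * e + 2 * Z) (eps := dl - e ^+ 2) :
  5 <= t -> 0 <= x -> 0 <= x + e -> 0 <= dl ->
  0 <= (t + 7) ^+ 2 / 12 * eps ^+ 2 + eps * Z * v + 3 * e ^+ 2 * Z ^+ 2.
Proof.
move=> t5 x0 xe dl0.
pose b := Z * v - (t + 7) ^+ 2 / 6 * e ^+ 2.
have vE : v = (t + 7) * e - 2 * (t - 1) * x by rewrite /v /Z; ring.
have bpos : 0 <= b ->
    0 <= (t + 7) ^+ 2 / 12 * eps ^+ 2 + eps * Z * v + 3 * e ^+ 2 * Z ^+ 2.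
  move=> b0.
  have -> : (t + 7) ^+ 2 / 12 * eps ^+ 2 + eps * Z * v + 3 * e ^+ 2 * Z ^+ 2
    = e ^+ 2 * ((1 - t) ^+ 2 * (x * (x + e)) + (t - 5) ^+ 2 / 12 * e ^+ 2)
      + dl * b + (t + 7) ^+ 2 / 12 * dl ^+ 2.
    by rewrite /b /eps /v /Z; field.
  have c12 u : 0 <= u ^+ 2 / 12 :> R by rewrite divr_ge0 ?sqr_ge0.
  apply: addr_ge0 (mulr_ge0 (c12 _) (sqr_ge0 _)).
  apply: addr_ge0 (mulr_ge0 dl0 b0).
  apply: mulr_ge0 (sqr_ge0 _) _.
  apply: addr_ge0 (mulr_ge0 (c12 _) (sqr_ge0 _)).
  exact: mulr_ge0 (sqr_ge0 _) (mulr_ge0 x0 xe).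
case: (lerP e 0) => e0.
  apply: bpos; rewrite /b.
  have tx : 0 <= (t - 1) * (x + e) by rewrite mulr_ge0 //; lra.
  have te : 0 <= (t - 1) * - e by rewrite mulr_ge0 //; lra.
  have Zle : (t + 1) * - e <= - Z by rewrite /Z; lra.
  have vle : (3 * t + 5) * - e <= - v by rewrite vE; lra.
  have h : (t + 1) * - e * ((3 * t + 5) * - e) <= - Z * - v.
    by rewrite ler_pM ?mulr_ge0 //; lra.
  (* The factor is 6 (t + 1) (3 t + 5) - (t + 7)^2, expanded at t = 5. *)
  have h2 : 0 <= e ^+ 2 * ((t - 5) * (17 * t + 119) + 576).
    by rewrite mulr_ge0 ?sqr_ge0 // addr_ge0 // mulr_ge0 //; lra.
  rewrite mulrNN in h; rewrite subr_ge0; apply: le_trans h; lra.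
have hvu : v <= (t + 7) * e.
  by rewrite vE gerBl !mulr_ge0 //; lra.
case: (lerP (- ((t + 7) * e)) v) => hvl.
  rewrite -(pmulr_rge0 _ (_ : 0 < (t + 7) ^+ 2 / 3)); last first.
    by rewrite divr_gt0 // exprn_gt0 //; lra.
  set F := (X in 0 <= X).
  have -> : F = ((t + 7) ^+ 2 / 6 * eps + Z * v) ^+ 2
    + Z ^+ 2 * (((t + 7) * e - v) * ((t + 7) * e + v)) by rewrite /F; field.
  by rewrite addr_ge0 ?sqr_ge0 // mulr_ge0 ?sqr_ge0 // mulr_ge0 //; lra.
apply: bpos.
have -> : b = v ^+ 2 / 2 - (t + 3) * e * v / 2 - (t + 7) ^+ 2 / 6 * e ^+ 2.
  by rewrite /b /v; field.
have h1 : ((t + 7) * e) ^+ 2 <= v ^+ 2.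
  rewrite -subr_ge0.
  have -> : v ^+ 2 - ((t + 7) * e) ^+ 2
    = ((t + 7) * e - v) * (- ((t + 7) * e) - v) by ring.
  by rewrite mulr_ge0; lra.
have h2 : 0 <= (t + 3) * e * - v.
  have te : 0 <= (t + 7) * e by rewrite mulr_ge0; lra.
  by rewrite !mulr_ge0; lra.
have h3 := sqr_ge0 v.
lra.
Qed.

(** A quartic symmetric form is affine in the product of three of its variables
when the fourth variable and the first two elementary symmetric functions of
the three are fixed. Fixing a leaves (a,x,x,y) and (a,0,x,y); fixing the 0 in
the latter leaves (0,x,x,y) and (0,0,x,y), all of which have a repeated
entry. *)
Lemma quartic_at_ge0 (R : rcfType) (A B C D E : R) :
  (forall x y z, 0 <= x -> 0 <= y -> 0 <= z ->
     0 <= quartic_at A B C D E x x y z) ->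
  forall a b c d, 0 <= a -> 0 <= b -> 0 <= c -> 0 <= d ->
    0 <= quartic_at A B C D E a b c d.
Proof.
move=> H.
have step a :
  (forall x y, 0 <= x -> 0 <= y -> 0 <= quartic_at A B C D E a x x y) ->
  (forall x y, 0 <= x -> 0 <= y -> 0 <= quartic_at A B C D E a 0 x y) ->
  forall x y z, 0 <= x -> 0 <= y -> 0 <= z -> 0 <= quartic_at A B C D E a x y z.
  pose U s q := A * (a + s) ^+ 4 + B * ((a + s) ^+ 2 * (a * s + q))
    + C * (a * s + q) ^+ 2 + D * ((a + s) * (a * q)).
  pose V s (q : R) := D * (a + s) + E * a.
  have UV x y z : quartic_at A B C D E a x y z =
      U (x + y + z) (x * y + x * z + y * z)
      + V (x + y + z) (x * y + x * z + y * z) * (x * y * z).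
    by rewrite /quartic_at /U /V; ring.
  move=> h2 h0 x y z x0 y0 z0; rewrite UV.
  apply: (ge0_of_affine_product (U := U) (V := V)) => // u v u0 v0.
    by rewrite -UV; exact: h2.
  by rewrite -UV; exact: h0.
move=> a b c d a0; apply: (step _) => x y x0 y0.
  have -> : quartic_at A B C D E a x x y = quartic_at A B C D E x x a y.
    by rewrite /quartic_at; ring.
  exact: H.
have -> : quartic_at A B C D E a 0 x y = quartic_at A B C D E 0 a x y.
  by rewrite /quartic_at; ring.
apply: (step _) => // u v u0 v0; last exact: H.
have -> : quartic_at A B C D E 0 u u v = quartic_at A B C D E u u 0 v.
  by rewrite /quartic_at; ring.
exact: H.
Qed.

Lemma fab_at_ge0 (R : rcfType) (t a b c d : R) : 0 <= t <= 5 ->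
  0 <= a -> 0 <= b -> 0 <= c -> 0 <= d ->
  0 <= cform_at 1 (- 2 * t) 0 (t ^+ 2) a b c d.
Proof.
move=> t05; apply: quartic_at_ge0 => x y z x0 y0 z0.
have h0 : 0 <= x + ((y + z) / 2 - x) by lra.
have := fab_kernel t05 x0 h0 (sqr_ge0 ((y - z) / 2)).
rewrite -(pmulr_rge0 _ (_ : 0 < 4 / 3)); last by lra.
by congr (0 <= _); rewrite /quartic_at; field.
Qed.

Lemma fc_at_ge0 (R : rcfType) (t a b c d : R) : 5 <= t ->
  0 <= a -> 0 <= b -> 0 <= c -> 0 <= d ->
  0 <= cform_at 1 (- 2 * t) (((t - 5) / 3) ^+ 2) (t ^+ 2) a b c d.
Proof.
move=> t5; apply: quartic_at_ge0 => x y z x0 y0 z0.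
have h0 : 0 <= x + ((y + z) / 2 - x) by lra.
have := fc_kernel t5 x0 h0 (sqr_ge0 ((y - z) / 2)).
rewrite -(pmulr_rge0 _ (_ : 0 < 4 / 3)); last by lra.
by congr (0 <= _); rewrite /quartic_at; field.
Qed.

Lemma p_at_ge0 (R : realFieldType) (a b c d : R) :
  0 <= cform_at 0 0 1 0 a b c d.
Proof.
have -> : cform_at 0 0 1 0 a b c d =
  ((a * b + c * d - a * c - b * d) ^+ 2 + (a * c + b * d - a * d - b * c) ^+ 2
   + (a * d + b * c - a * b - c * d) ^+ 2) / 2.
  by rewrite /cform_at /quartic_at; field.
by rewrite divr_ge0 // !addr_ge0 ?sqr_ge0.
Qed.

Lemma q1_at_ge0 (R : realFieldType) (a b c d : R) :
  0 <= a -> 0 <= b -> 0 <= c -> 0 <= d -> 0 <= cform_at 0 3 0 0 a b c d.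
Proof.
move=> a0 b0 c0 d0.
have -> : cform_at 0 3 0 0 a b c d =
  a * b * (a - b) ^+ 2 + a * c * (a - c) ^+ 2 + a * d * (a - d) ^+ 2
  + b * c * (b - c) ^+ 2 + b * d * (b - d) ^+ 2 + c * d * (c - d) ^+ 2.
  by rewrite /cform_at /quartic_at; field.
have T u v w : 0 <= u -> 0 <= v -> 0 <= u * v * w ^+ 2 :> R.
  by move=> u0 v0; apply: mulr_ge0 (mulr_ge0 u0 v0) (sqr_ge0 _).
by rewrite !addr_ge0 // T.
Qed.

Lemma q2_at_ge0 (R : realFieldType) (a b c d : R) :
  0 <= a -> 0 <= b -> 0 <= c -> 0 <= d -> 0 <= cform_at 0 0 0 3 a b c d.
Proof.
move=> a0 b0 c0 d0.
have -> : cform_at 0 0 0 3 a b c d =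
  a * b * (c - d) ^+ 2 + a * c * (b - d) ^+ 2 + a * d * (b - c) ^+ 2
  + b * c * (a - d) ^+ 2 + b * d * (a - c) ^+ 2 + c * d * (a - b) ^+ 2.
  by rewrite /cform_at /quartic_at; field.
have T u v w : 0 <= u -> 0 <= v -> 0 <= u * v * w ^+ 2 :> R.
  by move=> u0 v0; apply: mulr_ge0 (mulr_ge0 u0 v0) (sqr_ge0 _).
by rewrite !addr_ge0 // T.
Qed.

(** * Description of the cone by two quadratics *)

Definition quad_ge0 (R : realFieldType) (a b c : R) : Prop :=
  forall x, 0 <= x -> 0 <= a * x ^+ 2 + b * x + c.

Lemma quad_ge0_const (R : realFieldType) (a b c : R) : quad_ge0 a b c -> 0 <= c.
Proof. by move/(_ 0 (lexx 0)); rewrite expr0n /= !mulr0 !add0r. Qed.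

Lemma sqr_le0_eq0 (R : realDomainType) (x : R) : x ^+ 2 <= 0 -> x = 0.
Proof. by move=> h; apply/eqP; rewrite -sqrf_eq0 eq_le h sqr_ge0. Qed.

(** A zero in the interior of the half line is a double root. *)
Lemma quad_ge0_root (R : realFieldType) (a b c t : R) :
  0 <= a -> quad_ge0 a b c -> 0 < t -> a * t ^+ 2 + b * t + c = 0 ->
  b = - 2 * t * a /\ c = t ^+ 2 * a.
Proof.
move=> a0 h t0 z; have c0 := quad_ge0_const h.
have [a_gt0|a_le0] := ltrP 0 a; last first.
  have az : a = 0 by lra.
  have h2 := h (2 * t) ltac:(lra).
  move: z h2; rewrite az !mul0r !add0r => z h2.
  have c00 : c = 0 by lra.
  have /eqP : b * t = 0 by lra.
  by rewrite mulf_eq0 (gt_eqF t0) orbF => /eqP ->; rewrite c00 !mulr0.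
have tb : 0 <= a * t ^+ 2 by rewrite mulr_ge0 ?sqr_ge0.
have b0 : b <= 0.
  by rewrite -(pmulr_lle0 _ t0); lra.
have x0 : 0 <= - b / (2 * a) by rewrite divr_ge0 //; lra.
have := h _ x0.
have -> : a * (- b / (2 * a)) ^+ 2 + b * (- b / (2 * a)) + c
  = (4 * a * c - b ^+ 2) / (4 * a) by field; lra.
rewrite pmulr_lge0 ?invr_gt0; last by lra.
move=> disc.
have : (2 * a * t + b) ^+ 2 <= 0.
  have -> : (2 * a * t + b) ^+ 2
    = 4 * a * (a * t ^+ 2 + b * t + c) + (b ^+ 2 - 4 * a * c) by ring.
  by rewrite z; lra.
move=> /sqr_le0_eq0 e.
have bE : b = - 2 * t * a by lra.
by split=> //; move: z; rewrite bE => z; lra.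
Qed.

Lemma quad_ge0_slope (R : realFieldType) (a b : R) :
  0 <= a -> quad_ge0 a b 0 -> 0 <= b.
Proof.
move=> a0 h; rewrite leNgt; apply/negP => b0.
have := h (- b / (a + 1)) ltac:(by rewrite divr_ge0 //; lra).
have -> : a * (- b / (a + 1)) ^+ 2 + b * (- b / (a + 1)) + 0
  = - (b / (a + 1)) ^+ 2 by field; lra.
rewrite oppr_ge0 => /sqr_le0_eq0 /eqP; rewrite mulf_eq0 invr_eq0.
by move=> /orP[] /eqP; lra.
Qed.

Lemma lin_ge0_slope (R : realFieldType) (b c : R) : quad_ge0 0 b c -> 0 <= b.
Proof.
move=> h; have c0 := quad_ge0_const h.
rewrite leNgt; apply/negP => b0.
have := h ((c + 1) / - b) ltac:(by rewrite divr_ge0 //; lra).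
have -> : 0 * ((c + 1) / - b) ^+ 2 + b * ((c + 1) / - b) + c = - 1.
  by field; lra.
lra.
Qed.

Definition coneP (R : realFieldType) (A M K N : R) : Prop :=
  [/\ 0 <= A, quad_ge0 A M N & quad_ge0 A ((10 * A + M) / 3) K].

Lemma conePZ (R : realFieldType) (c A M K N : R) :
  0 <= c -> coneP A M K N -> coneP (c * A) (c * M) (c * K) (c * N).
Proof.
move=> c0 [A0 h1 h2]; split; first exact: mulr_ge0.
  move=> x /h1 h; have -> : c * A * x ^+ 2 + c * M * x + c * N
    = c * (A * x ^+ 2 + M * x + N) by ring.
  exact: mulr_ge0.
move=> x /h2 h.
have -> : c * A * x ^+ 2 + (10 * (c * A) + c * M) / 3 * x + c * K
  = c * (A * x ^+ 2 + (10 * A + M) / 3 * x + K) by field.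
exact: mulr_ge0.
Qed.

(** The least K for which A r^2 + (10A+M)/3 r + K is nonnegative on r >= 0 when
A = 1 and M = -2t: the vertex (t-5)/3 lies in the half line only for t >= 5. *)
Definition minK (R : realFieldType) (t : R) : R :=
  if t <= 5 then 0 else ((t - 5) / 3) ^+ 2.

(** For A > 0 the right choice of t is the minimizer of A x^2 + M x + N on the
half line, namely 0 if M >= 0 and -M/(2A) otherwise. Nonnegativity of the two
quadratics at t and at (t-5)/3 then bounds N and K from below. *)
Lemma cone_split (R : realFieldType) (A M K N : R) : coneP A M K N ->
  (A = 0 /\ [/\ 0 <= M, 0 <= K & 0 <= N]) \/
  0 < A /\ exists2 t, 0 <= t &
    [/\ 0 <= M - A * (- 2 * t), 0 <= K - A * minK t & 0 <= N - A * t ^+ 2].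
Proof.
move=> [A0 h1 h2]; have K0 := quad_ge0_const h2; have N0 := quad_ge0_const h1.
have [A_gt0|A_le0] := ltrP 0 A; last first.
  have Az : A = 0 by lra.
  by left; split=> //; split=> //; apply: (@lin_ge0_slope _ _ N); rewrite -Az.
right; split=> //; have [M0|M0] := lerP 0 M.
  exists 0; rewrite // /minK ler0n expr0n /= !mulr0 !subr0; split=> //.
pose t := - M / (2 * A).
have t0 : 0 <= t by rewrite divr_ge0 //; lra.
have ME : M = - 2 * (A * t) by rewrite /t; field; lra.
exists t => //; split.
- by rewrite ME; lra.
- rewrite /minK; case: (lerP t 5) => t5; first by rewrite mulr0 subr0.
  have := h2 ((t - 5) / 3) ltac:(lra).
  by congr (0 <= _); rewrite ME; field.
have := h1 t t0.
by congr (0 <= _); rewrite ME; ring.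
Qed.

(** Both one-parameter families at once: [fab] for t <= 5 and [fc] for
t >= 5. *)
Definition fgen (R : realType) (t : R) := cform 1 (- 2 * t) (minK t) (t ^+ 2).

Lemma fgen_fab (R : realType) (t : R) : t <= 5 -> fgen t = fab t.
Proof. by rewrite /fgen /minK fab_cform => ->. Qed.

Lemma fgen_fc (R : realType) (t : R) : 5 <= t -> fgen t = fc t.
Proof.
rewrite /fgen /minK fc_cform le_eqVlt => /orP[/eqP <-|].
  by rewrite lexx subrr mul0r expr0n.
by rewrite ltNge => /negPf ->.
Qed.

Lemma fgen_at_ge0 (R : realType) (t a b c d : R) : 0 <= t ->
  0 <= a -> 0 <= b -> 0 <= c -> 0 <= d ->
  0 <= cform_at 1 (- 2 * t) (minK t) (t ^+ 2) a b c d.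
Proof.
move=> t0; rewrite /minK; case: (lerP t 5) => t5.
  by apply: fab_at_ge0; rewrite t0.
exact: fc_at_ge0 (ltW t5).
Qed.

(** Necessity comes from the points (x,1,1,1) and (0,0,u,1), sufficiency from
[cone_split] and the nonnegativity of the generators. At x = 1 the form
vanishes whatever the first quadratic is, so there one argues from the values
at 1 + e and 1 - e for a small e. *)
Lemma inP_cform (R : realType) (A M K N : R) :
  inP (cform A M K N) <-> coneP A M K N.
Proof.
have nonneg x y z w : coneP A M K N ->
    0 <= x -> 0 <= y -> 0 <= z -> 0 <= w -> 0 <= cform_at A M K N x y z w.
  move=> h x0 y0 z0 w0.
  have p0 := p_at_ge0 x y z w.
  have q10 := q1_at_ge0 x0 y0 z0 w0.
  have q20 := q2_at_ge0 x0 y0 z0 w0.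
  have [[-> [M0 K0 N0]]|[A0 [t t0 [M0 K0 N0]]]] := cone_split h.
    have -> : cform_at 0 M K N x y z w = M / 3 * cform_at 0 3 0 0 x y z w
      + K * cform_at 0 0 1 0 x y z w + N / 3 * cform_at 0 0 0 3 x y z w.
      by rewrite /cform_at /quartic_at; field.
    by rewrite !addr_ge0 // mulr_ge0 // divr_ge0.
  have f0 := fgen_at_ge0 t0 x0 y0 z0 w0.
  have -> : cform_at A M K N x y z w =
      A * cform_at 1 (- 2 * t) (minK t) (t ^+ 2) x y z w
      + (M - A * (- 2 * t)) / 3 * cform_at 0 3 0 0 x y z w
      + (K - A * minK t) * cform_at 0 0 1 0 x y z w
      + (N - A * t ^+ 2) / 3 * cform_at 0 0 0 3 x y z w.
    by rewrite /cform_at /quartic_at; field.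
  by rewrite !addr_ge0 // mulr_ge0 // ?divr_ge0 // ltW.
split=> [[_ _ _ h]|h]; last first.
  split.
  - by rewrite cform_quartic sym_quartic.
  - by rewrite cform_quartic homog_quartic.
  - by rewrite meval_cform_pt cform_at_x111; ring.
  move=> a a0; rewrite meval_cform; exact: nonneg.
have pos x y z w :
    0 <= x -> 0 <= y -> 0 <= z -> 0 <= w -> 0 <= cform_at A M K N x y z w.
  move=> x0 y0 z0 w0; rewrite -meval_cform_pt; apply: h => i.
  by rewrite /pt (tnth_nth 0); case: i => -[|[|[|[|]]]].
have A0 : 0 <= A.
  have := pos 0 0 1 0 (lexx 0) (lexx 0) ler01 (lexx 0).
  by congr (0 <= _); rewrite cform_at_001x; ring.
have x111 x : 0 <= x -> x != 1 -> 0 <= A * x ^+ 2 + M * x + N.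
  move=> x0 x1; have := pos _ _ _ _ x0 ler01 ler01 ler01.
  rewrite cform_at_x111 pmulr_rge0 // exprn_even_gt0 //= subr_eq0 //.
split=> // x x0.
  have [->|/x111] := eqVneq x 1; last exact.
  rewrite leNgt; apply/negP => n1.
  (* If the value at 1 is -g < 0, the values at 1 + e and 1 - e have sum
     2 (A e^2 - g), which is negative for this e. *)
  pose g := - (A * 1 ^+ 2 + M * 1 + N); pose e := g / (A + g).
  have g0 : 0 < g by rewrite oppr_gt0.
  have e0 : 0 < e by rewrite divr_gt0 //; lra.
  have e1 : e <= 1 by rewrite ler_pdivrMr; lra.
  have hp := x111 (1 + e) ltac:(lra) ltac:(by apply/eqP; lra).
  have hm := x111 (1 - e) ltac:(lra) ltac:(by apply/eqP; lra).
  have le : e * (A + g) = g by rewrite /e; field; lra.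
  have ee : A * e ^+ 2 <= A * e.
    by apply: ler_wpM2l => //; rewrite expr2 -[leRHS]mulr1 ler_wpM2l // ltW.
  have : 0 < e * g by rewrite mulr_gt0.
  have : 0 <= A * e ^+ 2 - g by rewrite /g; lra.
  lra.
have [->|xn0] := eqVneq x 0.
  have := pos 0 0 1 1 (lexx 0) (lexx 0) ler01 ler01.
  by congr (0 <= _); rewrite cform_at_001x; field.
have xp : 0 < x by rewrite lt_def xn0.
(* The point (0, 0, u, 1) with (u - 1)^2 / u = x. *)
pose s := Num.sqrt (x ^+ 2 + 4 * x).
have ss : s ^+ 2 = x ^+ 2 + 4 * x.
  by rewrite sqr_sqrtr // addr_ge0 ?sqr_ge0 //; lra.
have s0 : 0 <= s by exact: sqrtr_ge0.
pose u := (2 + x + s) / 2.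
have u0 : 0 < u by rewrite divr_gt0 //; lra.
have uu : (u - 1) ^+ 2 = x * u.
  have -> : (u - 1) ^+ 2 = (x ^+ 2 + 2 * x * s + s ^+ 2) / 4.
    by rewrite /u; field.
  by rewrite ss /u; field.
have := pos 0 0 u 1 (lexx 0) (lexx 0) (ltW u0) ler01.
rewrite cform_at_001x.
have -> : A * (u - 1) ^+ 4 + (10 * A + M) / 3 * ((u - 1) ^+ 2 * (u * 1))
    + K * (u * 1) ^+ 2
  = u ^+ 2 * (A * x ^+ 2 + (10 * A + M) / 3 * x + K).
  by rewrite (exprM _ 2 2) uu; ring.
by rewrite pmulr_rge0 // exprn_gt0.
Qed.

Lemma inP_cformP (R : realType) (f : {mpoly R[4]}) : inP f ->
  exists A M K N, f = cform A M K N /\ coneP A M K N.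
Proof.
move=> Pf; have [fs fh f1 _] := Pf.
have [A [B [C [D [E fE]]]]] := quartic_of_sym_homog fs fh.
have fC : f = cform A (3 * B + 14 * A) (16 * A + 4 * B + C)
    (81 * A + 27 * B + 9 * C + 3 * D).
  move: f1; rewrite fE meval_quartic /pt !(tnth_nth 0) /= /quartic_at => f1.
  by rewrite cform_quartic; congr quartic; lra.
do 4!eexists; split; first exact: fC.
by apply/inP_cform; rewrite -fC.
Qed.

Lemma cform_inj (R : realType) (A M K N A' M' K' N' : R) :
  cform A M K N = cform A' M' K' N' -> [/\ A = A', M = M', K = K' & N = N'].
Proof.
move=> e.
have at_ a b c d : cform_at A M K N a b c d = cform_at A' M' K' N' a b c d.
  by rewrite -!meval_cform_pt e.
have h1 := at_ 0 0 1 0; have h2 := at_ 0 0 1 1; have h3 := at_ 0 1 1 1.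
have h4 := at_ 2 1 1 1.
rewrite !cform_at_001x in h1 h2; rewrite !cform_at_x111 in h3 h4.
by split; lra.
Qed.

(** * Extremal elements *)

Lemma coneP_A0 (R : realFieldType) (M K N : R) :
  0 <= M -> 0 <= K -> 0 <= N -> coneP 0 M K N.
Proof.
move=> M0 K0 N0; split=> // x x0; rewrite !(mul0r, add0r, mulr0) addr_ge0 //.
  exact: mulr_ge0.
by rewrite mulr_ge0 // divr_ge0.
Qed.

Lemma coneP_fgen (R : realFieldType) (t : R) : 0 <= t ->
  coneP 1 (- 2 * t) (minK t) (t ^+ 2).
Proof.
move=> t0; split=> // x x0.
  have -> : 1 * x ^+ 2 + - 2 * t * x + t ^+ 2 = (x - t) ^+ 2 by ring.
  exact: sqr_ge0.
rewrite /minK; case: (lerP t 5) => t5.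
  by rewrite addr0 mul1r addr_ge0 ?sqr_ge0 // mulr_ge0 //; lra.
have -> : 1 * x ^+ 2 + (10 * 1 + - 2 * t) / 3 * x + ((t - 5) / 3) ^+ 2
  = (x - (t - 5) / 3) ^+ 2 by field.
exact: sqr_ge0.
Qed.

Lemma coneP_pointed (R : realFieldType) (k A M K N : R) : k < 0 ->
  coneP A M K N -> coneP (k * A) (k * M) (k * K) (k * N) ->
  [/\ A = 0, M = 0, K = 0 & N = 0].
Proof.
move=> k0 [A0 h1 h2] [A0' h1' h2'].
have z x : 0 <= x -> 0 <= k * x -> x = 0.
  by move=> x0; rewrite nmulr_rge0 // => x0'; apply/eqP; rewrite eq_le x0 x0'.
have Az : A = 0 by exact: z.
have Kz : K = 0 by exact: z (quad_ge0_const h2) (quad_ge0_const h2').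
have Nz : N = 0 by exact: z (quad_ge0_const h1) (quad_ge0_const h1').
split=> //; move: h1 h1'; rewrite Az mulr0 => h1 h1'.
by apply: z; [exact: lin_ge0_slope h1|exact: lin_ge0_slope h1'].
Qed.

Lemma cform0 (R : realType) : cform 0 0 0 0 = 0 :> {mpoly R[4]}.
Proof. by have := cformZ 0 (0 : R) 0 0 0; rewrite scale0r !mul0r. Qed.

(** Extremality makes a e a multiple of f; the factor cannot be negative since
the cone contains no line. *)
Lemma extremal_summand (R : realType) (a : R) (f e h : {mpoly R[4]}) :
  extremal f -> 0 < a -> inP e -> e != 0 -> inP h -> f = a *: e + h ->
  exists2 c : R, 0 < c & f = c *: e.
Proof.
move=> [Pf fn0 ext] a0 Pe en0 Ph fE.
have [A [M [K [N [eE ce]]]]] := inP_cformP Pe.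
have Pae : inP (a *: e).
  by rewrite eE cformZ; apply/inP_cform/conePZ => //; exact: ltW.
have [[c cE] _] := ext _ _ Pae Ph fE.
have c0 : c != 0.
  apply: contraNneq en0 => cz; move: cE; rewrite cz scale0r => /eqP.
  by rewrite scaler_eq0 (gt_eqF a0).
have fe : f = (a / c) *: e.
  by rewrite mulrC -scalerA cE scalerA mulVf // scale1r.
exists (a / c) => //; rewrite ltNge le_eqVlt; apply/negP => /orP[/eqP z|neg].
  by move: fn0; rewrite fe z scale0r eqxx.
have cf : coneP (a / c * A) (a / c * M) (a / c * K) (a / c * N).
  by apply/inP_cform; rewrite -cformZ -eE -fe.
have [A0 M0 K0 N0] := coneP_pointed neg ce cf.
by move: en0; rewrite eE A0 M0 K0 N0 cform0 eqxx.
Qed.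

Lemma cform_neq0 (R : realType) (A M K N : R) :
  ~ [/\ A = 0, M = 0, K = 0 & N = 0] -> cform A M K N != 0.
Proof. by move=> h; apply/eqP; rewrite -cform0 => /cform_inj. Qed.

Lemma extremal_cform (R : realType) (A M K N : R) :
  coneP A M K N -> ~ [/\ A = 0, M = 0, K = 0 & N = 0] ->
  (forall A1 M1 K1 N1 A2 M2 K2 N2, coneP A1 M1 K1 N1 -> coneP A2 M2 K2 N2 ->
     A = A1 + A2 -> M = M1 + M2 -> K = K1 + K2 -> N = N1 + N2 ->
     exists c, [/\ A1 = c * A, M1 = c * M, K1 = c * K & N1 = c * N]) ->
  extremal (cform A M K N).
Proof.
move=> cv vn0 face; split; [exact/inP_cform|exact: cform_neq0|].
have mul g h : inP g -> inP h -> cform A M K N = g + h ->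
    exists c, g = c *: cform A M K N.
  move=> /inP_cformP [A1 [M1 [K1 [N1 [-> c1]]]]].
  move=> /inP_cformP [A2 [M2 [K2 [N2 [-> c2]]]]].
  rewrite cformD => /cform_inj [eA eM eK eN].
  have [c [eA1 eM1 eK1 eN1]] := face _ _ _ _ _ _ _ _ c1 c2 eA eM eK eN.
  by exists c; rewrite cformZ eA1 eM1 eK1 eN1.
move=> g h Pg Ph e; split; first exact: mul e.
by apply: (mul h g) => //; rewrite addrC.
Qed.

Lemma extremalZ (R : realType) (c : R) (f : {mpoly R[4]}) :
  0 < c -> extremal f -> extremal (c *: f).
Proof.
move=> c0 [Pf fn0 ext].
have PZ (k : R) g : 0 < k -> inP g -> inP (k *: g).
  move=> k0 /inP_cformP [A [M [K [N [-> cv]]]]].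
  by rewrite cformZ; apply/inP_cform/conePZ => //; exact: ltW.
split; [exact: PZ|by rewrite scaler_eq0 negb_or gt_eqF|].
move=> g h Pg Ph e.
have ci : 0 < c^-1 by rewrite invr_gt0.
have cn : c != 0 by rewrite gt_eqF.
have [[x gx] [y hy]] :
    (exists x : R, c^-1 *: g = x *: f) /\ (exists y : R, c^-1 *: h = y *: f).
  apply: ext; [exact: PZ|exact: PZ|].
  by rewrite -scalerDr -e scalerA mulVf // scale1r.
split; [exists x|exists y].
  by rewrite scalerA mulrC -scalerA -gx scalerA mulfV // scale1r.
by rewrite scalerA mulrC -scalerA -hy scalerA mulfV // scale1r.
Qed.

Lemma ge0_sum0 (R : realDomainType) (x y : R) :
  0 <= x -> 0 <= y -> x + y = 0 -> x = 0.
Proof. by move=> x0 y0 /eqP; rewrite paddr_eq0 // => /andP[/eqP]. Qed.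

(** If two quadratics nonnegative on the half line add up to a multiple of
(x-t)^2 with t >= 0, each is a multiple of (x-t)^2: both vanish at t. At the
boundary point t = 0 this only kills the constant terms, and the slopes vanish
because they are nonnegative with sum 0. *)
Lemma quad_ge0_face (R : realFieldType) (a1 b1 c1 a2 b2 c2 t : R) :
  0 <= a1 -> 0 <= a2 -> quad_ge0 a1 b1 c1 -> quad_ge0 a2 b2 c2 -> 0 <= t ->
  b1 + b2 = - 2 * t * (a1 + a2) -> c1 + c2 = t ^+ 2 * (a1 + a2) ->
  b1 = - 2 * t * a1 /\ c1 = t ^+ 2 * a1.
Proof.
move=> a10 a20 h1 h2; rewrite le_eqVlt => /orP[/eqP <-|t0] eb ec.
  rewrite expr0n /= !(mulr0, mul0r) in eb ec *.
  have c1z := ge0_sum0 (quad_ge0_const h1) (quad_ge0_const h2) ec.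
  have c2z : c2 = 0 by lra.
  move: h1 h2; rewrite c1z c2z.
  move=> /(quad_ge0_slope a10) b10 /(quad_ge0_slope a20) b20.
  by split=> //; exact: ge0_sum0 eb.
apply: (quad_ge0_root a10 h1 t0).
apply: (ge0_sum0 (h1 t (ltW t0)) (h2 t (ltW t0))).
have -> : a1 * t ^+ 2 + b1 * t + c1 + (a2 * t ^+ 2 + b2 * t + c2)
  = (a1 + a2) * t ^+ 2 + (b1 + b2) * t + (c1 + c2) by ring.
by rewrite eb ec; ring.
Qed.

Lemma extremal_fgen (R : realType) (t : R) : 0 <= t -> extremal (fgen t).
Proof.
move=> t0; apply: extremal_cform; first exact: coneP_fgen.
  by move=> [/eqP]; rewrite oner_eq0.
move=> A1 M1 K1 N1 A2 M2 K2 N2 [A10 h1 k1] [A20 h2 k2] eA eM eK eN.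
have [M1E N1E] : M1 = - 2 * t * A1 /\ N1 = t ^+ 2 * A1.
  by apply: (quad_ge0_face A10 A20 h1 h2 t0); rewrite -?eM -?eN -eA mulr1.
exists A1; rewrite mulr1 mulrC [_ * t ^+ 2]mulrC; split=> //.
move: eK; rewrite /minK; case: (lerP t 5) => t5 eK.
  by rewrite mulr0; exact: (ge0_sum0 (quad_ge0_const k1) (quad_ge0_const k2)).
have r0 : 0 <= (t - 5) / 3 by lra.
have [_ ->] : (10 * A1 + M1) / 3 = - 2 * ((t - 5) / 3) * A1 /\
    K1 = ((t - 5) / 3) ^+ 2 * A1.
  apply: (quad_ge0_face A10 A20 k1 k2 r0).
    have -> : M2 = - 2 * t - M1 by lra.
    have -> : A2 = 1 - A1 by lra.
    by field.
  by rewrite -eK -eA mulr1.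
by rewrite mulrC.
Qed.

Lemma extremal_p (R : realType) : extremal (p R).
Proof.
rewrite p_cform; apply: extremal_cform; first by apply: coneP_A0.
  by move=> [_ _ /eqP]; rewrite oner_eq0.
move=> A1 M1 K1 N1 A2 M2 K2 N2 [A10 h1 k1] [A20 h2 k2] eA eM eK eN.
have A1z := ge0_sum0 A10 A20 (esym eA).
have A2z : A2 = 0 by lra.
have N1z := ge0_sum0 (quad_ge0_const h1) (quad_ge0_const h2) (esym eN).
move: (h1) (h2); rewrite A1z A2z => /lin_ge0_slope M10 /lin_ge0_slope M20.
have M1z := ge0_sum0 M10 M20 (esym eM).
by exists K1; rewrite !mulr0 mulr1.
Qed.

Lemma extremal_q1 (R : realType) : extremal (q1 R).
Proof.
rewrite q1_cform; apply: extremal_cform; first by apply: coneP_A0.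
  by move=> [_ /eqP]; rewrite pnatr_eq0.
move=> A1 M1 K1 N1 A2 M2 K2 N2 [A10 h1 k1] [A20 h2 k2] eA eM eK eN.
have A1z := ge0_sum0 A10 A20 (esym eA).
have N1z := ge0_sum0 (quad_ge0_const h1) (quad_ge0_const h2) (esym eN).
have K1z := ge0_sum0 (quad_ge0_const k1) (quad_ge0_const k2) (esym eK).
by exists (M1 / 3); rewrite !mulr0; split=> //; field.
Qed.

Lemma extremal_q2 (R : realType) : extremal (q2 R).
Proof.
rewrite q2_cform; apply: extremal_cform; first by apply: coneP_A0.
  by move=> [_ _ _ /eqP]; rewrite pnatr_eq0.
move=> A1 M1 K1 N1 A2 M2 K2 N2 [A10 h1 k1] [A20 h2 k2] eA eM eK eN.
have A1z := ge0_sum0 A10 A20 (esym eA).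
have A2z : A2 = 0 by lra.
have K1z := ge0_sum0 (quad_ge0_const k1) (quad_ge0_const k2) (esym eK).
move: (h1) (h2); rewrite A1z A2z => /lin_ge0_slope M10 /lin_ge0_slope M20.
have M1z := ge0_sum0 M10 M20 (esym eM).
by exists (N1 / 3); rewrite !mulr0; split=> //; field.
Qed.

Lemma extremal_cases (R : realType) (f : {mpoly R[4]}) : extremal f ->
  exists2 c : R, 0 < c &
    (exists2 t : R, 0 <= t & f = c *: fgen t) \/
    f = c *: p R \/ f = c *: q1 R \/ f = c *: q2 R.
Proof.
move=> ext; have [Pf fn0 _] := ext.
have inPe (e : {mpoly R[4]}) : extremal e -> inP e /\ e != 0 by case.
have [Pp pn0] := inPe _ (extremal_p R).
have [Pq1 q1n0] := inPe _ (extremal_q1 R).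
have [Pq2 q2n0] := inPe _ (extremal_q2 R).
have [A [M [K [N [fE cf]]]]] := inP_cformP Pf.
have [[Az [M0 K0 N0]]|[A0 [t t0 [M0 K0 N0]]]] := cone_split cf; last first.
  have [Pg gn0] := inPe _ (extremal_fgen t0).
  have [|c c0 e] := extremal_summand ext A0 Pg gn0
    (proj2 (inP_cform _ _ _ _) (coneP_A0 M0 K0 N0)).
    by rewrite fE /fgen cformZ cformD; congr cform; ring.
  by exists c => //; left; exists t.
move: M0; rewrite le_eqVlt => /orP[/eqP Mz|M0]; last first.
  have [|||c c0 e] :=
    extremal_summand (a := M / 3) (h := cform 0 0 K N) ext _ Pq1 q1n0.
  - by rewrite divr_gt0.
  - by apply/inP_cform/coneP_A0.
  - by rewrite fE q1_cform cformZ cformD Az; congr cform; field.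
  - by exists c => //; right; right; left.
move: K0; rewrite le_eqVlt => /orP[/eqP Kz|K0]; last first.
  have [||c c0 e] := extremal_summand (h := cform 0 0 0 N) ext K0 Pp pn0.
  - by apply/inP_cform/coneP_A0.
  - by rewrite fE p_cform cformZ cformD Az -Mz; congr cform; ring.
  - by exists c => //; right; left.
move: N0; rewrite le_eqVlt => /orP[/eqP Nz|N0]; last first.
  have [|||c c0 e] :=
    extremal_summand (a := N / 3) (h := cform 0 0 0 0) ext _ Pq2 q2n0.
  - by rewrite divr_gt0.
  - by apply/inP_cform/coneP_A0.
  - by rewrite fE q2_cform cformZ cformD Az -Mz -Kz; congr cform; field.
  - by exists c => //; right; right; right.
by move: fn0; rewrite fE Az -Mz -Kz -Nz cform0 eqxx.
Qed.

(** * Equality conditions *)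

Lemma characterized_cform (R : realType) (C : {mpoly R[4]} -> Prop)
    (A M K N : R) :
  coneP A M K N ->
  (forall c, C (cform (c * A) (c * M) (c * K) (c * N))) ->
  (forall A' M' K' N', coneP A' M' K' N' -> C (cform A' M' K' N') ->
     exists2 c, 0 <= c &
       [/\ A' = c * A, M' = c * M, K' = c * K & N' = c * N]) ->
  characterized C (cform A M K N).
Proof.
move=> cv Cv only g; split.
  move=> [/inP_cformP [A' [M' [K' [N' [-> cv']]]]] /(only _ _ _ _ cv')].
  by move=> [c c0 [-> -> -> ->]]; exists c; rewrite // cformZ.
move=> [c c0 ->]; rewrite cformZ; split; last exact: Cv.
exact/inP_cform/conePZ.
Qed.

Lemma cform_at_xx11 (R : realFieldType) (A M K N x : R) :
  cform_at A M K N x x 1 1 =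
  (x - 1) ^+ 2 * (K * (x - 1) ^+ 2 + 4 / 3 * (A + M + N) * x).
Proof. by rewrite /cform_at /quartic_at; field. Qed.

Lemma cform_at_0011 (R : realFieldType) (A M K N : R) :
  cform_at A M K N 0 0 1 1 = K.
Proof. by rewrite cform_at_001x; ring. Qed.

Lemma cform_at_0111 (R : realFieldType) (A M K N : R) :
  cform_at A M K N 0 1 1 1 = N.
Proof. by rewrite cform_at_x111; ring. Qed.

Lemma characterized_fgen_ab (R : realType) (t : R) : 0 < t < 1 \/ 1 < t <= 5 ->
  characterized (fun g => g.@[pt t 1 1 1] = 0 /\ g.@[pt 0 0 1 1] = 0) (fgen t).
Proof.
move=> t15; have [t0 t1 t5] : [/\ 0 < t, t != 1 & t <= 5].
  by case: t15 => /andP[ta tb]; split;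
    rewrite ?(lt_eqF tb) ?(gt_eqF ta) //; lra.
have mk : minK t = 0 by rewrite /minK t5.
apply: characterized_cform; first exact: coneP_fgen (ltW t0).
  move=> c; rewrite !meval_cform_pt cform_at_0011 cform_at_x111 mk.
  by split; ring.
move=> A M K N [A0 h1 h2]; rewrite !meval_cform_pt cform_at_0011 cform_at_x111.
move=> [/eqP]; rewrite mulf_eq0 sqrf_eq0 subr_eq0 (negPf t1) => /eqP z Kz.
have [ME NE] := quad_ge0_root A0 h1 t0 z.
by exists A => //; rewrite mk mulr0 mulr1 ME NE; split=> //; ring.
Qed.

(** At the boundary zero (0,1,1,1) the derivative M - 2N has to be prescribed,
as the vanishing of N leaves M >= 0 free. *)
Lemma characterized_fgen0 (R : realType) :
  characterized (fun g => [/\ g.@[pt 0 1 1 1] = 0,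
                              (g^`M(ord0)).@[pt 0 1 1 1] = 0
                            & g.@[pt 0 0 1 1] = 0]) (fgen (0 : R)).
Proof.
have mk : minK (0 : R) = 0 by rewrite /minK ler0n.
apply: characterized_cform; first exact: coneP_fgen.
  move=> c; rewrite !meval_cform_pt mderiv0_cform_0111.
  rewrite cform_at_0011 cform_at_0111 mk.
  by split; ring.
move=> A M K N [A0 h1 h2].
rewrite !meval_cform_pt mderiv0_cform_0111 cform_at_0011 cform_at_0111.
move=> [Nz dz Kz]; exists A => //.
by rewrite mk expr0n /= !mulr0 mulr1; split=> //; lra.
Qed.

(** The double zero of (x-1)^2 at t = 1 is hidden by the factor (x-1)^2 of
f(x,1,1,1); the second derivative at (1,1,1,1) is 2(A + M + N). *)
Lemma characterized_fgen1 (R : realType) :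
  characterized (fun g => (forall t : R, 0 <= t -> g.@[pt t t 1 1] = 0) /\
                          ((g^`M(ord0))^`M(ord0)).@[pt 1 1 1 1] = 0)
    (fgen (1 : R)).
Proof.
have mk : minK (1 : R) = 0 by rewrite /minK ler1n.
apply: characterized_cform; first exact: coneP_fgen.
  move=> c; rewrite mderiv00_cform_1111; split; last by ring.
  by move=> t t0; rewrite meval_cform_pt cform_at_xx11 mk; field.
move=> A M K N [A0 h1 h2]; rewrite mderiv00_cform_1111 => -[z dz].
have := z 0 (lexx 0); rewrite meval_cform_pt cform_at_0011 => Kz.
have z1 : A * 1 ^+ 2 + M * 1 + N = 0 by lra.
have [ME NE] := quad_ge0_root A0 h1 ltr01 z1.
by exists A => //; rewrite mk mulr0 mulr1 ME NE; split=> //; ring.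
Qed.

(** The equation for u says that (u-1)^2 / u = (t-5)/3, the double root of the
second quadratic. *)
Lemma characterized_fgen_c (R : realType) (t u : R) : 5 < t -> 0 <= u ->
  3 * u ^+ 2 - (t + 1) * u + 3 = 0 ->
  characterized (fun g => g.@[pt t 1 1 1] = 0 /\ g.@[pt 0 0 u 1] = 0) (fgen t).
Proof.
move=> t5 u0 uz; have t0 : 0 < t by lra.
have t1 : t != 1 by apply/eqP; lra.
have un0 : u != 0.
  apply: contra_eq_neq uz => ->.
  by rewrite expr0n /= !mulr0 subrr add0r pnatr_eq0.
have mk : minK t = ((t - 5) / 3) ^+ 2 by rewrite /minK leNgt t5.
have at_u A M K N : cform_at A M K N 0 0 u 1 =
    u ^+ 2 * (A * ((t - 5) / 3) ^+ 2 + (10 * A + M) / 3 * ((t - 5) / 3) + K).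
  have uu : (u - 1) ^+ 2 = (t - 5) / 3 * u.
    by apply: (mulfI (_ : 3 != 0 :> R)); rewrite ?pnatr_eq0 //; lra.
  by rewrite cform_at_001x (exprM _ 2 2) uu; ring.
apply: characterized_cform; first exact: coneP_fgen (ltW t0).
  by move=> c; rewrite !meval_cform_pt at_u cform_at_x111 mk; split; field.
move=> A M K N [A0 h1 h2]; rewrite !meval_cform_pt at_u cform_at_x111.
move=> [/eqP]; rewrite mulf_eq0 sqrf_eq0 subr_eq0 (negPf t1) => /eqP z.
move=> /eqP; rewrite mulf_eq0 sqrf_eq0 (negPf un0) => /eqP z2.
have [ME NE] := quad_ge0_root A0 h1 t0 z.
have r0 : 0 < (t - 5) / 3 by lra.
have [_ KE] := quad_ge0_root A0 h2 r0 z2.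
by exists A => //; rewrite mk mulr1 ME NE KE; split=> //; ring.
Qed.

Lemma characterized_p (R : realType) :
  characterized (fun g => [/\ g.@[pt 0 0 0 1] = 0,
                              (g^`M(ord0)).@[pt 0 0 0 1] = 0
                            & forall x : R, 0 <= x -> g.@[pt x 1 1 1] = 0])
    (p R).
Proof.
rewrite p_cform; apply: characterized_cform; first by apply: coneP_A0.
  move=> c; rewrite !meval_cform_pt mderiv0_cform_0001 cform_at_001x.
  by split; [ring|ring|move=> x x0; rewrite meval_cform_pt cform_at_x111; ring].
move=> A M K N [A0 h1 h2].
rewrite !meval_cform_pt mderiv0_cform_0001 cform_at_001x.
move=> [z1 z2 /(_ 0 (lexx 0))]; rewrite meval_cform_pt cform_at_0111 => Nz.
have Az : A = 0 by lra.
exists K; first exact: quad_ge0_const h2.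
by rewrite !mulr0 mulr1; split=> //; lra.
Qed.

Lemma characterized_q1 (R : realType) :
  characterized (fun g : {mpoly R[4]} =>
                   [/\ g.@[pt 1 1 1 0] = 0, g.@[pt 1 1 0 0] = 0
                     & g.@[pt 1 0 0 0] = 0])
    (q1 R).
Proof.
have [at3 at2 at1] : [/\ forall A M K N : R, cform_at A M K N 1 1 1 0 = N,
    forall A M K N : R, cform_at A M K N 1 1 0 0 = K
  & forall A M K N : R, cform_at A M K N 1 0 0 0 = A].
  by split=> A M K N; rewrite /cform_at /quartic_at; field.
rewrite q1_cform; apply: characterized_cform; first by apply: coneP_A0.
  by move=> c; rewrite !meval_cform_pt at3 at2 at1 !mulr0.
move=> A M K N [A0 h1 h2]; rewrite !meval_cform_pt at3 at2 at1 => -[Nz Kz Az].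
exists (M / 3); last by rewrite !mulr0; split=> //; field.
by rewrite divr_ge0 //; apply: (@lin_ge0_slope _ _ N); rewrite -Az.
Qed.

Lemma characterized_q2 (R : realType) :
  characterized (fun g => forall s : R, 0 <= s -> g.@[pt s 1 0 0] = 0) (q2 R).
Proof.
have at_s (A M K N s : R) : cform_at A M K N s 1 0 0
    = A * (s - 1) ^+ 4 + (10 * A + M) / 3 * ((s - 1) ^+ 2 * s) + K * s ^+ 2.
  by rewrite /cform_at /quartic_at; field.
rewrite q2_cform; apply: characterized_cform; first by apply: coneP_A0.
  by move=> c s s0; rewrite meval_cform_pt at_s; ring.
move=> A M K N [A0 h1 h2] z.
have := z 0 (lexx 0); have := z 1 ler01; have := z 2 ltac:(lra).
rewrite !meval_cform_pt !at_s => z2 z1 z0.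
exists (N / 3); first by rewrite divr_ge0 //; exact: quad_ge0_const h1.
by rewrite !mulr0; split; lra.
Qed.

(** * Expressions of q1 and q2 as sums *)

Lemma sum_ord4 (V : nmodType) (F : 'I_4 -> V) :
  \sum_(i < 4) F i = F i0 + F i1 + F i2 + F i3.
Proof.
rewrite !big_ord_recl big_ord0 addr0 !addrA.
by congr (F _ + F _ + F _ + F _); apply: val_inj.
Qed.

Lemma q1_sum (R : realType) :
  q1 R = \sum_(i < 4) \sum_(j < 4 | (i < j)%N) 'X_i * 'X_j * ('X_i - 'X_j) ^+ 2.
Proof.
have [s1 s2 s3 s4] := sigmaE R.
under eq_bigr do rewrite big_mkcond.
rewrite !sum_ord4 /= !(addr0, add0r) /q1 !scaler_nat s1 s2 s3.
ring.
Qed.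

(** Permutations of four points are the same as quadruples of distinct points,
which turns a sum over the symmetric group into sums that unfold. *)
Lemma sum_perm4 (V : nmodType) (F : 'I_4 -> 'I_4 -> 'I_4 -> 'I_4 -> V) :
  \sum_(s : 'S_4) F (s i0) (s i1) (s i2) (s i3) =
  \sum_i \sum_j \sum_k \sum_l if uniq [:: i; j; k; l] then F i j k l else 0.
Proof.
under [RHS]eq_bigr => i _ do (under eq_bigr => j _ do rewrite pair_big /=).
under [RHS]eq_bigr => i _ do rewrite pair_big /=.
rewrite pair_big /= -big_mkcond /=.
pose h (s : 'S_4) := (s i0, (s i1, (s i2, s i3))).
have ordP (P : 'I_4 -> Prop) : P i0 -> P i1 -> P i2 -> P i3 -> forall i, P i.
  move=> P0 P1 P2 P3 [[|[|[|[|//]]]] lti].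
  - by rewrite (_ : Ordinal lti = i0) //; apply: val_inj.
  - by rewrite (_ : Ordinal lti = i1) //; apply: val_inj.
  - by rewrite (_ : Ordinal lti = i2) //; apply: val_inj.
  - by rewrite (_ : Ordinal lti = i3) //; apply: val_inj.
have h_inj : injective h.
  by move=> s s' [e0 e1 e2 e3]; apply/permP; apply: ordP.
transitivity (\sum_(x in h @: [set: 'S_4]) F x.1 x.2.1 x.2.2.1 x.2.2.2).
  rewrite big_imset /=; last by move=> s s' _ _; apply: h_inj.
  by apply: eq_bigl => s; rewrite inE.
apply: eq_bigl => -[a [b [c d]]] /=.
apply/imsetP/idP => [[s _ [-> -> -> ->]]|abcd].
  rewrite -[X in is_true X]/(uniq (map s [:: i0; i1; i2; i3])) map_inj_uniq //.
  exact: perm_inj.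
have tinj : injective (tnth [tuple a; b; c; d]) by apply/tuple_uniqP.
exists (perm tinj); first by rewrite inE.
by rewrite /h !permE !(tnth_nth a).
Qed.

Lemma q2_sum (R : realType) :
  q2 R = (4^-1 : R) *: \sum_(tau : 'S_4)
            'X_(tau 0) * 'X_(tau 1) * ('X_(tau 2) - 'X_(tau 3)) ^+ 2.
Proof.
have [s1 s2 s3 s4] := sigmaE R.
have -> : (3 : 'I_4) = i3 by apply: val_inj.
have -> : (2 : 'I_4) = i2 by apply: val_inj.
have -> : (1 : 'I_4) = i1 by apply: val_inj.
have -> : (0 : 'I_4) = i0 by apply: val_inj.
pose T i j k l : {mpoly R[4]} := 'X_i * 'X_j * ('X_k - 'X_l) ^+ 2.
rewrite (sum_perm4 T).
rewrite !sum_ord4 /=.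
rewrite !(addr0, add0r).
rewrite /q2 !scaler_nat s1 s3 s4.
apply: (scalerI (_ : (4 : R) != 0)); first by rewrite pnatr_eq0.
rewrite scalerA mulfV ?pnatr_eq0 // scale1r scaler_nat /T.
ring.
Qed.

Theorem theorem1p4 (R : realType) :
  (q1 R = \sum_(i < 4) \sum_(j < 4 | (i < j)%N)
            'X_i * 'X_j * ('X_i - 'X_j) ^+ 2) /\
  (q2 R = (4^-1 : R) *: \sum_(tau : 'S_4)
            'X_(tau 0) * 'X_(tau 1) * ('X_(tau 2) - 'X_(tau 3)) ^+ 2) /\
  (forall f : {mpoly R[4]},
     extremal f <->
     exists2 c : R, 0 < c &
       (exists2 t : R, 0 <= t <= 5 & f = c *: fab t) \/
       (exists2 t : R, 5 <= t & f = c *: fc t) \/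
       f = c *: p R \/ f = c *: q1 R \/ f = c *: q2 R) /\
  (forall t : R, 0 < t < 1 \/ 1 < t <= 5 ->
     characterized (fun g => g.@[pt t 1 1 1] = 0 /\ g.@[pt 0 0 1 1] = 0)
       (fab t)) /\
  characterized (fun g => [/\ g.@[pt 0 1 1 1] = 0,
                              (g^`M(ord0)).@[pt 0 1 1 1] = 0
                            & g.@[pt 0 0 1 1] = 0])
    (fab (0 : R)) /\
  characterized (fun g => (forall t : R, 0 <= t -> g.@[pt t t 1 1] = 0) /\
                          ((g^`M(ord0))^`M(ord0)).@[pt 1 1 1 1] = 0)
    (fab (1 : R)) /\
  (forall t : R, 5 < t ->
     forall u : R, 0 <= u -> 3 * u ^+ 2 - (t + 1) * u + 3 = 0 ->
     characterized (fun g => g.@[pt t 1 1 1] = 0 /\ g.@[pt 0 0 u 1] = 0)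
       (fc t)) /\
  characterized (fun g => [/\ g.@[pt 0 0 0 1] = 0,
                              (g^`M(ord0)).@[pt 0 0 0 1] = 0
                            & forall x : R, 0 <= x -> g.@[pt x 1 1 1] = 0])
    (p R) /\
  characterized (fun g => [/\ g.@[pt 1 1 1 0] = 0, g.@[pt 1 1 0 0] = 0
                            & g.@[pt 1 0 0 0] = 0])
    (q1 R) /\
  characterized (fun g => forall s : R, 0 <= s -> g.@[pt s 1 0 0] = 0)
    (q2 R).
Proof.
split; first exact: q1_sum.
split; first exact: q2_sum.
split.
  move=> f; split.
    move=> /extremal_cases [c c0 H]; exists c => //.
    case: H => [[t t0 fE]|H]; last by right; right.
    have [t5|t5] := lerP t 5.
      by left; exists t; rewrite ?t0 // -fgen_fab.
    by right; left; exists t; rewrite ?ltW // -fgen_fc // ltW.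
  move=> [c c0 [[t /andP[t0 t5] ->]|[[t t5 ->]|[->|[->|->]]]]].
  - by apply: extremalZ => //; rewrite -fgen_fab //; exact: extremal_fgen.
  - apply: extremalZ => //; rewrite -fgen_fc //; apply: extremal_fgen.
    exact: le_trans t5.
  - exact: extremalZ c0 (extremal_p R).
  - exact: extremalZ c0 (extremal_q1 R).
  - exact: extremalZ c0 (extremal_q2 R).
split.
  move=> t ht; rewrite -fgen_fab; first exact: characterized_fgen_ab.
  by case: ht => /andP[_]; lra.
split; first by rewrite -fgen_fab ?ler0n //; exact: characterized_fgen0.
split; first by rewrite -fgen_fab ?ler1n //; exact: characterized_fgen1.
split.
  by move=> t t5 u u0 hu; rewrite -fgen_fc ?ltW //; exact: characterized_fgen_c.
split; first exact: characterized_p.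
split; first exact: characterized_q1.
exact: characterized_q2.
Qed.
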